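(* Let $m$ be a positive integer and let $\xi_m\in\mathbb{C}$ be a primitive $m$-th root of unity. For any positive integer $n$, write $n=mk+i$ with integers $k\ge 0$ and $0\le i\le m-1$. Then, as formal power series in $t$, $$ \frac{A_{n}(t,q,\xi_m)}{(t;q)_{n+1}} = \frac{A_i(t,q,\xi_m)}{(t;q)_{i+1}} \otimes \frac{A_k(t,q^m)}{(t;q^m)_{k+1}}, $$ where $\otimes$ denotes the Hadamard product of power series in $t$.
   Context: $t,q,p$ are indeterminates. $\mathfrak{S}_n$ is the symmetric group on $\{1,\dots,n\}$. For $\sigma=\sigma_1\cdots\sigma_n\in\mathfrak{S}_n$ (one-line notation): $\mathrm{inv}(\sigma)=\#\{(i,j)\mid 1\le i<j\le n,\ \sigma_i>\sigma_j\}$, $\mathrm{des}(\sigma)=\#\{i\mid 1\le i\le n-1,\ \sigma_i>\sigma_{i+1}\}$, and $\mathrm{maj}(\sigma)=\sum\{i\mid 1\le i\le n-1,\ \sigma_i>\sigma_{i+1}\}$ (the sum of the descent positions). Define $$A_n(t,q,p)=\sum_{\sigma\in\mathfrak{S}_n}t^{\mathrm{des}(\sigma)}q^{\mathrm{maj}(\sigma)}p^{\mathrm{inv}(\sigma)},\qquad A_n(t,q):=A_n(t,q,1),\qquad A_0=1.$$ $A_k(t,q^m)$ is $A_k(t,q)$ with $q$ replaced by $q^m$. The $q$-ascending factorial is $(a;q)_0=1$, $(a;q)_n=(1-a)(1-aq)\cdots(1-aq^{n-1})$ for $n\ge1$. Fractions are expanded as formal power series in $t$. The Hadamard product of two power series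 in $t$ is $\big(\sum_{\ell\ge0}a_\ell t^\ell\big)\otimes\big(\sum_{\ell\ge0}b_\ell t^\ell\big)=\sum_{\ell\ge0}a_\ell b_\ell t^\ell$ (the coefficients $a_\ell,b_\ell$ may depend on $q$). *)

(* Defs.v *)
From HB Require Import structures.
From mathcomp Require Import all_boot all_order all_algebra all_fingroup.
From mathcomp Require Import complex reals.

Set Implicit Arguments.
Unset Strict Implicit.
Unset Printing Implicit Defensive.

Import GRing.Theory.
Local Open Scope ring_scope.

(* Permutations of {1, ..., n} are rendered as 'S_n, which permutes
   {0, ..., n-1}: the 0-based i : 'I_n stands for the position i.+1. *)
Definition perm_inv (n : nat) (s : 'S_n) : nat :=
  #|[set ij : 'I_n * 'I_n | (ij.1 < ij.2)%N && (s ij.2 < s ij.1)%N]|.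

Definition descent (n : nat) (s : 'S_n) (i : 'I_n) : bool :=
  [exists j : 'I_n, (j == i.+1 :> nat) && (s j < s i)%N].

Definition perm_des (n : nat) (s : 'S_n) : nat := #|[set i | descent s i]|.

Definition perm_maj (n : nat) (s : 'S_n) : nat := (\sum_(i | descent s i) i.+1)%N.

(* A_n(t,q,p) at arbitrary elements of a commutative ring; the polynomial
   itself is recovered by taking indeterminates for t, q and p. *)
Definition Euler3 (S : comNzRingType) (n : nat) (t q p : S) : S :=
  \sum_(s : 'S_n) t ^+ perm_des s * q ^+ perm_maj s * p ^+ perm_inv s.

Definition Euler2 (S : comNzRingType) (n : nat) (t q : S) : S :=
  Euler3 n t q 1.

Definition qasc (S : comNzRingType) (a q : S) (n : nat) : S :=
  \prod_(j < n) (1 - a * q ^+ j).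

(* A formal power series is its sequence of coefficients. *)
Definition hadamard (S : comNzRingType) (a b : nat -> S) : nat -> S :=
  fun l => a l * b l.

(* Expansion of f / g for a denominator g with constant term 1:
   f / g = f * (1 + (1 - g) + (1 - g) ^+ 2 + ...), where the powers beyond the
   l-th do not contribute to the coefficient of degree l (see fps_divP). *)
Definition fps_div (S : comNzRingType) (f g : {poly S}) : nat -> S :=
  fun l => (f * \sum_(k < l.+1) (1 - g) ^+ k)`_l.

Lemma coef_expr_lt (S : comNzRingType) (h : {poly S}) (k l : nat) :
  h`_0 = 0 -> (l < k)%N -> (h ^+ k)`_l = 0.
Proof.
move=> h0; elim: k l => // k IHk l lt_lk.
rewrite exprS coefM big1 // => -[[|j] /= lt_jl] _; first by rewrite h0 mul0r.
rewrite ltnS in lt_lk; rewrite ltnS in lt_jl.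
rewrite IHk ?mulr0 //; apply: leq_trans lt_lk.
by rewrite ltn_subrL /= (leq_ltn_trans (leq0n j) lt_jl).
Qed.

Lemma fps_divE (S : comNzRingType) (f g : {poly S}) (N l : nat) :
  g`_0 = 1 -> (l <= N)%N ->
  (f * \sum_(k < N.+1) (1 - g) ^+ k)`_l = fps_div f g l.
Proof.
move=> g0; have h0 : (1 - g)`_0 = 0 by rewrite coefB coef1 g0 subrr.
elim: N => [|N IHN]; first by rewrite leqn0 => /eqP ->.
rewrite leq_eqVlt => /predU1P[-> // | le_lN].
rewrite big_ord_recr mulrDr coefD IHN // coefM big1 ?addr0 // => j _.
by rewrite coef_expr_lt ?mulr0 // (leq_ltn_trans _ le_lN) // leq_subr.
Qed.

Lemma fps_divP (S : comNzRingType) (f g : {poly S}) (l : nat) :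
  g`_0 = 1 -> \sum_(j < l.+1) g`_j * fps_div f g (l - j)%N = f`_l.
Proof.
move=> g0; have h0 : (1 - g)`_0 = 0 by rewrite coefB coef1 g0 subrr.
transitivity ((g * (f * \sum_(k < l.+1) (1 - g) ^+ k))`_l).
  by rewrite coefM; apply: eq_bigr => j _; rewrite (@fps_divE _ f g l) // leq_subr.
have -> : g * (f * \sum_(k < l.+1) (1 - g) ^+ k) = f - f * (1 - g) ^+ l.+1.
  have := subrX1 (1 - g) l.+1; rewrite addrAC subrr add0r mulNr.
  move/(congr1 -%R); rewrite opprK opprB => eq_g.
  by rewrite mulrCA -eq_g mulrBr mulr1.
rewrite coefB [X in _ - X]coefM big1 ?subr0 // => j _.
by rewrite coef_expr_lt ?mulr0 // ltnS leq_subr.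
Qed.

Lemma qasc_coef0 (S : comNzRingType) (q : S) (n : nat) :
  (qasc 'X q%:P n)`_0 = 1.
Proof.
rewrite -horner_coef0 horner_prod big1 // => j _.
by rewrite !hornerE subr0.
Qed.

(* Main.v *)
Require Import Defs.
From HB Require Import structures.
From mathcomp Require Import all_boot all_order all_algebra all_fingroup.
From mathcomp Require Import complex reals.
From mathcomp Require Import boolp functions.
From mathcomp Require Import ring zify.

Set Implicit Arguments.
Unset Strict Implicit.
Unset Printing Implicit Defensive.

Import GRing.Theory.
Local Open Scope ring_scope.
Local Open Scope complex_scope.

(* The coefficient of t^l in A_n(t,q,p) / (t;q)_(n+1) is
     G_n(l) = \sum_w q^(w_1 + ... + w_n) p^(#{a < b | w_a < w_b}),
   w ranging over the words of length n in the letters 0, ..., l: the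
   permutation that sorts the positions of w by decreasing letter, ties from
   left to right, has #{a < b | w_a < w_b} inversions, and the words sorted by
   a given permutation have generating function t^des q^maj / (t;q)_(n+1).

   Reading w letter by letter gives G_n(l) = (T^n 1)(1, q, ..., q^l), where
   T = X_0 + ... + X_l acts on functions of x = (x_0, ..., x_l) and X_j
   multiplies by x_j after scaling by p the x_i with i > j.  For j < l,
   X_j X_l = p X_l X_j, so if p is a primitive m-th root of unity the
   q-binomial theorem gives T^m = X_0^m + ... + X_l^m, which is multiplication
   by x_0^m + ... + x_l^m.  Hence
     G_(mk+i)(l) = (1 + q^m + ... + q^(lm))^k G_i(l),
   and the case m = 1 identifies the first factor as the coefficient of t^l in
   A_k(t,q^m) / (t;q^m)_(k+1). *)

(** * Power series in t and the generating function of chains *)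

Section PowerSeries.
Variable S : comNzRingType.
Implicit Types (f g : {poly S}) (h : nat -> S).

Definition fps_mul g h : nat -> S := fun l => \sum_(j < l.+1) g`_j * h (l - j)%N.

Lemma fps_mulE g h N l : (l < N)%N -> fps_mul g h l = (g * \poly_(j < N) h j)`_l.
Proof.
move=> ltlN; rewrite coefM; apply: eq_bigr => j _.
by rewrite coef_poly (leq_ltn_trans (leq_subr _ _) ltlN).
Qed.

Lemma fps_mulA g1 g2 h : fps_mul g1 (fps_mul g2 h) =1 fps_mul (g1 * g2) h.
Proof.
move=> l; rewrite [RHS](fps_mulE _ _ (ltnSn l)) -mulrA coefM; apply: eq_bigr => j _.
by congr (_ * _); rewrite (@fps_mulE _ _ l.+1) // ltnS leq_subr.
Qed.

Lemma eq_fps_mul g h1 h2 : h1 =1 h2 -> fps_mul g h1 =1 fps_mul g h2.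
Proof. by move=> eqh l; apply: eq_bigr => j _; rewrite eqh. Qed.

(** As the constant term of [g] is 1, the equation in degree l determines [h l] from the earlier
    values. *)
Lemma fps_div_unique f g h :
  g`_0 = 1 -> (forall l, fps_mul g h l = f`_l) -> fps_div f g =1 h.
Proof.
move=> g0 gh l; elim/ltn_ind: l => l IHl.
have := fps_divP f l g0; rewrite -(gh l) /fps_mul !big_ord_recl /= g0 !mul1r subn0.
move=> eqs; apply: (addIr (\sum_(i < l) g`_(bump 0 i) * h (l - bump 0 i)%N)).
rewrite -{}eqs; congr (_ + _); apply: eq_bigr => i _.
by rewrite IHl // /bump /= add1n ltn_subrL (leq_ltn_trans _ (ltn_ord i)).
Qed.

Lemma fps_div_suml (I : Type) (r : seq I) (F : I -> {poly S}) g l :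
  fps_div (\sum_(i <- r) F i) g l = \sum_(i <- r) fps_div (F i) g l.
Proof. by rewrite /fps_div mulr_suml coef_sum. Qed.

Lemma fps_div_mulC f c g l : fps_div (f * c%:P) g l = fps_div f g l * c.
Proof. by rewrite /fps_div mulrAC coefMC. Qed.

Lemma fps_mul_1subX h l :
  fps_mul (1 - 'X) (fun l => \sum_(v < l.+1) h v) l = h l.
Proof.
rewrite /fps_mul big_ord_recl !coefE /= subr0 mul1r subn0.
case: l => [|l]; first by rewrite big_ord_recr !big_ord0 /= addr0 add0r.
rewrite [X in _ + X]big_ord_recl !coefE /= sub0r mulN1r [X in - _ + X]big1 => [|i _].
  by rewrite subSS subn0 addr0 big_ord_recr /= addrAC subrr add0r.
by rewrite !coefE /= subr0 mul0r.
Qed.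

Lemma coef_comp_scaleX g c j : (g \Po (c *: 'X))`_j = c ^+ j * g`_j.
Proof.
rewrite comp_polyE coef_sum.
under eq_bigr => i _ do rewrite exprZn !coefZ coefXn.
have [ltj|lej] := ltnP j (size g).
  rewrite (bigD1 (Ordinal ltj)) //= eqxx mulr1 mulrC big1 ?addr0 // => i.
  by rewrite -val_eqE /= eq_sym => /negPf->; rewrite !mulr0.
rewrite [g`_j]nth_default // mulr0 big1 // => i _.
by rewrite (gtn_eqF (leq_trans (ltn_ord i) lej)) !mulr0.
Qed.

Lemma fps_mul_scaleX g h q l :
  fps_mul (g \Po (q *: 'X)) (fun v => q ^+ v * h v) l = q ^+ l * fps_mul g h l.
Proof.
rewrite /fps_mul mulr_sumr; apply: eq_bigr => j _.
by rewrite coef_comp_scaleX mulrACA -exprD (subnKC (leq_ord j)).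
Qed.

(** Multiplication by t^b on coefficient sequences. *)
Definition fps_shift (b : bool) h : nat -> S :=
  fun v => if (b <= v)%N then h (v - b)%N else 0.

Lemma fps_mul_shift g h b l : fps_mul g (fps_shift b h) l = fps_shift b (fps_mul g h) l.
Proof.
case: b; last by rewrite /fps_shift !subn0 /=; apply: eq_fps_mul => v; rewrite subn0.
rewrite /fps_shift; case: l => [|l] /=; first by rewrite /fps_mul big_ord1 /= mulr0.
rewrite /fps_mul big_ord_recr /= subnn /= mulr0 addr0 subn1.
by apply: eq_bigr => j _; rewrite (subSn (leq_ord j)) subn1.
Qed.

Lemma qasc_recl q n :
  qasc ('X : {poly S}) q%:P n.+1 = (1 - 'X) * (qasc ('X : {poly S}) q%:P n \Po (q *: 'X)).
Proof.
rewrite /qasc big_ord_recl expr0 mulr1 rmorph_prod; congr (_ * _).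
apply: eq_bigr => j _ /=.
rewrite !(rmorphB, rmorph1, rmorphM, rmorphXn) /= comp_polyX comp_polyC.
by rewrite /bump exprS mulrA -[in RHS]mul_polyC [_ * 'X]mulrC.
Qed.

(* The sum of q ^+ (f_0 + ... + f_(n-1)) over l >= f_0 >= f_1 >= ... >= f_n = 0
   with f_i > f_(i+1) whenever d i. *)
Fixpoint chain_sum (q : S) n (d : nat -> bool) (l : nat) : S :=
  if n is n'.+1 then
    \sum_(v < l.+1) q ^+ v * fps_shift (d 0) (chain_sum q n' (fun i => d i.+1)) v
  else 1.

(** Induction on n through (t;q)_(n+2) = (1 - t) (qt;q)_(n+1): the factor 1 - t undoes the summation
    over v, substituting qt for t absorbs [q ^+ v], and a shift by [d 0] remains. *)
Lemma chain_sumP q n (d : nat -> bool) l :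
  fps_div ('X ^+ (\sum_(i < n) d i) * (q ^+ (\sum_(i < n) d i * i.+1)%N)%:P)
    (qasc ('X : {poly S}) q%:P n.+1) l = chain_sum q n d l.
Proof.
apply: fps_div_unique; first exact: qasc_coef0.
elim: n d {l} => [|n IHn] d l.
  rewrite !big_ord0 /qasc big_ord1 /= !expr0 !mulr1.
  rewrite /fps_mul big_ord_recl !coefE /= mulr1 subr0.
  case: l => [|l]; first by rewrite big_ord0 addr0.
  rewrite big_ord_recl !coefE /= sub0r mulr1 big1 => [|i _]; first by rewrite addr0 subrr.
  by rewrite !coefE /= subr0 mul0r.
rewrite qasc_recl mulrC -fps_mulA.
rewrite (eq_fps_mul _ (fps_mul_1subX _ :
  _ =1 fun v => q ^+ v * fps_shift (d 0) (chain_sum q n (fun i => d i.+1)) v)).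
rewrite fps_mul_scaleX fps_mul_shift /fps_shift IHn.
rewrite !big_ord_recl /= muln1.
(* Dropping f_0 lowers the position of each later strict step by one; the missing q per strict step
   comes from the factor [q ^+ l] of the substitution. *)
have -> : (\sum_(i < n) d (bump 0 i) * (bump 0 i).+1 =
   \sum_(i < n) d i.+1 * i.+1 + \sum_(i < n) d i.+1)%N.
  by rewrite -big_split; apply: eq_bigr => i _ /=; rewrite [RHS]addnC -mulnS.
rewrite !coefMC !coefXn; case: (d 0) => /=; last first.
  rewrite !add0n subn0; case: eqP => [->|_]; last by rewrite !mul0r mulr0.
  by rewrite !mul1r -exprD addnC.
rewrite !add1n; case: l => [|l] /=; first by rewrite mulr0 mul0r.
rewrite subn1 /= eqSS; case: eqP => [->|_]; last by rewrite !mul0r mulr0.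
by rewrite !mul1r -exprD addnC addnS.
Qed.

End PowerSeries.

(** * Gaussian binomials and q-commuting operators *)

Section QBinomial.
Variables (S : comNzRingType) (p : S).

(** Gaussian binomial coefficients; the q-Pascal rule needs no division, so [p] may be any ring
    element. *)
Fixpoint qbinom (n k : nat) : S :=
  match n, k with
  | _, 0 => 1
  | 0, _.+1 => 0
  | n'.+1, k'.+1 => qbinom n' k' + p ^+ k'.+1 * qbinom n' k'.+1
  end.

Lemma qbinom0 n : qbinom n 0 = 1. Proof. by case: n. Qed.

Lemma qbinom_small n k : (n < k)%N -> qbinom n k = 0.
Proof.
elim: n k => [|n IHn] [|k] //= ltnk.
by rewrite !IHn ?mulr0 ?addr0 // ltnW.
Qed.

Lemma qbinomnn n : qbinom n n = 1.
Proof. by elim: n => //= n ->; rewrite qbinom_small // mulr0 addr0. Qed.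

(** The ratio of consecutive Gaussian binomials, without division. For k > n the truncated [n - k]
    is harmless, as both sides vanish. *)
Lemma mul_qbinom_left n k :
  (1 - p ^+ k.+1) * qbinom n k.+1 = (1 - p ^+ (n - k)) * qbinom n k.
Proof.
elim: n k => [|n IHn] k; first by rewrite sub0n expr0 subrr mul0r mulr0.
have [lt_nk|] := ltnP n k.
  by rewrite [qbinom _ k.+1]qbinom_small // mulr0 (eqP lt_nk) expr0 subrr mul0r.
move=> le_kn /=; rewrite mulrDr mulrCA IHn.
case: k le_kn => [|k] le_kn; first by rewrite !qbinom0 subn0 !exprS; ring.
rewrite /= subSS [in RHS]mulrDr -(IHn k) -(subnSK le_kn).
move: (n - k.+1)%N => e.
rewrite !exprS; ring.
Qed.

(** The ratio rule starts with the factor 1 - p^m = 0; vanishing then propagates in k, each 1 -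
    p^(k+1) being cancellable. *)
Lemma mul_qbinom_prim m k :
  m.-primitive_root p -> (forall a, (0 < a < m)%N -> GRing.lreg (1 - p ^+ a)) ->
  (0 < k < m)%N -> qbinom m k = 0.
Proof.
move=> prim_p reg_p; elim: k => // k IHk /= lt_km.
apply: (reg_p k.+1) => //=; rewrite mulr0 mul_qbinom_left.
case: k IHk lt_km => [|k] IHk lt_km.
  by rewrite subn0 prim_expr_order // subrr mul0r.
by rewrite IHk ?mulr0 //= ltnW.
Qed.

Section Operators.
Variables (V : lmodType S) (A B : {linear V -> V}).
Hypothesis AB : forall v, A (B v) = p *: B (A v).

Lemma iter_qcomm k v : A (iter k B v) = p ^+ k *: iter k B (A v).
Proof.
elim: k => [|k IHk] /=; first by rewrite scale1r.
by rewrite AB IHk linearZ scalerA exprS.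
Qed.

(** The q-binomial theorem: moving A past B^a costs p^a, which is the weight in the q-Pascal
    rule. *)
Lemma iter_add_qcomm n v :
  iter n (fun u => A u + B u) v =
  \sum_(a < n.+1) qbinom n a *: iter a B (iter (n - a) A v).
Proof.
elim: n => [|n IHn]; first by rewrite big_ord1 /= scale1r.
rewrite iterS IHn !linear_sum /=.
rewrite big_ord_recl [in RHS]big_ord_recl /= !qbinom0 !linearZ /= !scale1r -addrA.
congr (_ + _); first by rewrite subn0.
rewrite [X in _ + X]big_ord_recr /= linearZ /= subnn qbinomnn scale1r.
rewrite [in RHS]big_ord_recr /= add0n qbinomnn [qbinom n n.+1]qbinom_small // mulr0 addr0.
rewrite /bump /= add1n subnn scale1r addrA -big_split.
congr (_ + _) => /=; apply: eq_bigr => i _.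
rewrite add0n add1n -!iterS !linearZ_LR iter_qcomm scalerA [RHS]scalerDl addrC; congr (_ + _).
by rewrite -iterS subSS subnSK // mulrC.
Qed.

End Operators.

(** The inner coefficients vanish, leaving only the terms a = 0 and a = m. *)
Lemma iter_add_qcomm_prim (V : lmodType S) (A B : {linear V -> V}) m v :
  (forall v, A (B v) = p *: B (A v)) ->
  m.-primitive_root p -> (forall a, (0 < a < m)%N -> GRing.lreg (1 - p ^+ a)) ->
  iter m (fun u => A u + B u) v = iter m A v + iter m B v.
Proof.
move=> AB prim_p reg_p; rewrite iter_add_qcomm //.
have := prim_order_gt0 prim_p; case: m prim_p reg_p => // m prim_p reg_p _.
rewrite big_ord_recl big_ord_recr [bigop _ _ _]big1 => [|i _].
  by rewrite Monoid.mul1m qbinom0 lift0 qbinomnn !scale1r subnn.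
by rewrite mul_qbinom_prim ?scale0r // lift0 /= ltnS ltn_ord.
Qed.


(** * Letter operators and their sum *)

Definition qscale (j : nat) (x : nat -> S) : nat -> S :=
  fun i => if (j < i)%N then p * x i else x i.

Lemma qscaleC i j x : qscale i (qscale j x) = qscale j (qscale i x).
Proof. by apply: funext => k; rewrite /qscale; do 2!case: ifP. Qed.

Section WordOperators.
Variable V : lmodType S.
Implicit Types (f : (nat -> S) -> V) (x : nat -> S).

(** The operator X_j; [x] is an infinite family, so that alphabets of all sizes act on the same
    space. *)
Definition letter_op j f x : V := x j *: f (qscale j x).

Definition word_op l f x : V := \sum_(j < l) letter_op j f x.

Fact letter_op_linear j : linear (letter_op j).
Proof.
move=> a f g; apply: funext => x.
by rewrite /letter_op !(addrfctE, scalrfctE) scalerDr !scalerA mulrC.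
Qed.
HB.instance Definition _ j := GRing.isLinear.Build S _ _ _ _ (letter_op_linear j).

Fact word_op_linear l : linear (word_op l).
Proof.
move=> a f g; apply: funext => x.
rewrite !(addrfctE, scalrfctE) scaler_sumr -big_split.
by apply: eq_bigr => j _; rewrite linearP !(addrfctE, scalrfctE).
Qed.
HB.instance Definition _ l := GRing.isLinear.Build S _ _ _ _ (word_op_linear l).

(** Reading a letter j < l first turns x_l into p x_l, whereas reading l first leaves x_j
    unchanged. *)
Lemma word_op_letter_op l f :
  word_op l (letter_op l f) = p *: letter_op l (word_op l f).
Proof.
apply: funext => x; rewrite [in RHS]scalrfctE /letter_op /word_op !scaler_sumr.
apply: eq_bigr => j _; rewrite /letter_op qscaleC !scalerA.
have -> : qscale j x l = p * x l by rewrite /qscale ltn_ord.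
have -> : qscale l x j = x j by rewrite /qscale ltnNge ltnW.
by congr (_ *: _); ring.
Qed.

Lemma word_opS l f : word_op l.+1 f = word_op l f + letter_op l f.
Proof. by apply: funext => x; rewrite /word_op big_ord_recr. Qed.

Lemma iter_qscale n j x i :
  iter n (qscale j) x i = if (j < i)%N then p ^+ n * x i else x i.
Proof.
elim: n => [|n IHn]; first by rewrite mul1r if_same.
by rewrite /= {1}/qscale IHn; case: ifP => ltji; rewrite ltji // exprS mulrA.
Qed.

Lemma iter_letter_op n j f x :
  iter n (letter_op j) f x = x j ^+ n *: f (iter n (qscale j) x).
Proof.
elim: n x => [|n IHn] x; first by rewrite scale1r.
transitivity (x j *: iter n (letter_op j) f (qscale j x)) => //.
rewrite IHn scalerA iterSr.
by rewrite {1}/qscale ltnn exprS.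
Qed.

(** Induction on l: the top letter q-commutes with the sum of the lower ones, so m-th powers add. *)
Lemma iter_word_op_prim m l f x :
  m.-primitive_root p -> (forall a, (0 < a < m)%N -> GRing.lreg (1 - p ^+ a)) ->
  iter m (word_op l) f x = (\sum_(j < l) x j ^+ m) *: f x.
Proof.
move=> prim_p reg_p; elim: l => [|l IHl].
  rewrite big_ord0 scale0r; case: m prim_p {reg_p} => [/prim_order_gt0//|m _] /=.
  by rewrite /word_op big_ord0.
rewrite (eq_iter (word_opS l)) (iter_add_qcomm_prim _ (word_op_letter_op l) prim_p reg_p).
rewrite addrfctE IHl iter_letter_op big_ord_recr /= scalerDl.
(* The m-fold scaling is by p^m = 1, so X_l^m merely multiplies by x_l^m. *)
congr (_ + _ *: f _); apply: funext => i.
by rewrite iter_qscale prim_expr_order // mul1r if_same.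
Qed.

Lemma iter_word_op_mul m k i l f x :
  m.-primitive_root p -> (forall a, (0 < a < m)%N -> GRing.lreg (1 - p ^+ a)) ->
  iter (m * k + i) (word_op l) f x =
    (\sum_(j < l) x j ^+ m) ^+ k *: iter i (word_op l) f x.
Proof.
move=> prim_p reg_p; elim: k => [|k IHk]; first by rewrite muln0 scale1r.
by rewrite mulnS -addnA iterD iter_word_op_prim // IHk exprS scalerA.
Qed.

End WordOperators.

End QBinomial.

(** * Generating function of words *)

Lemma big_tuple_cons (R : Type) (idx : R) (op : Monoid.com_law idx) (T : finType) n
    (P : pred (n.+1.-tuple T)) (F : n.+1.-tuple T -> R) :
  \big[op/idx]_(w | P w) F w =
  \big[op/idx]_x \big[op/idx]_(w : n.-tuple T | P [tuple of x :: w]) F [tuple of x :: w].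
Proof.
rewrite pair_big_dep /=.
rewrite (reindex (fun xw : T * n.-tuple T => [tuple of xw.1 :: xw.2])) //=.
exists (fun w : n.+1.-tuple T => (thead w, [tuple of behead w])) => [[x w]|w] _ /=.
  by rewrite theadE; congr (_, _); apply: val_inj.
by rewrite -tuple_eta.
Qed.

Definition coinv (T : finType) (r : rel T) n (w : n.-tuple T) : nat :=
  (\sum_(a < n) \sum_(b < n | (a < b)%N) r (tnth w a) (tnth w b))%N.

Lemma coinv_cons (T : finType) (r : rel T) n x (w : n.-tuple T) :
  coinv r [tuple of x :: w] = (\sum_(b < n) r x (tnth w b) + coinv r w)%N.
Proof.
rewrite /coinv big_ord_recl; congr (_ + _)%N.
  rewrite big_mkcond big_ord_recl /= add0n.
  by apply: eq_bigr => b _; rewrite tnthS.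
apply: eq_bigr => a _; rewrite big_mkcond big_ord_recl /= add0n [RHS]big_mkcond.
by apply: eq_bigr => b _; rewrite !tnthS.
Qed.

(** A first letter j contributes x_j, and [qscale j] puts one p on each later letter exceeding j,
    one per pair counted at the first position. *)
Lemma word_sum (S : comNzRingType) (p : S) n l (x : nat -> S) :
  \sum_(w : n.-tuple 'I_l)
     (\prod_(a < n) x (tnth w a)) * p ^+ coinv (fun a b : 'I_l => (a < b)%N) w =
  iter n (word_op p l) (fun=> 1 : S^o) x.
Proof.
elim: n x => [|n IHn] x.
  rewrite (bigD1 [tuple]) //= [X in _ + X]big1 ?addr0 => [|w /eqP[]]; last exact: tuple0.
  by rewrite /coinv !big_ord0 mul1r.
rewrite big_tuple_cons iterS /= {1}/word_op.
apply: eq_bigr => j _; rewrite /letter_op -IHn scaler_sumr.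
apply: eq_bigr => w _; rewrite big_ord_recl tnth0  -mulrA -[RHS]/(_ * _); congr (_ * _).
rewrite coinv_cons exprD mulrA; congr (_ * _).
rewrite expr_sum -big_split; apply: eq_bigr => a _ /=.
by rewrite tnthS /qscale mulrC; case: ifP => _; rewrite ?mul1r.
Qed.

(** * Chains as tuples *)

Section Chains.
Variable S : comNzRingType.

(** Mirrors the recursion of [chain_sum]; [d 0 <= v] guards the truncated subtraction. *)
Fixpoint chain (d : nat -> bool) (l : nat) (s : seq nat) : bool :=
  if s is v :: s' then [&& v <= l, d 0 <= v & chain (fun i => d i.+1) (v - d 0) s']%N
  else true.

(** The default 0 past the end of [s] serves as f_n = 0, so [d] at the last index bounds the last
    entry from below. *)
Lemma chainP (d : nat -> bool) l s :
  reflect ((head 0 s <= l)%N /\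
           forall i, (i < size s)%N -> (nth 0 s i.+1 + d i <= nth 0 s i)%N)
          (chain d l s).
Proof.
elim: s d l => [|v s IHs] d l /=; first by constructor.
apply: (iffP and3P) => [[-> le_d /IHs[hd ch]]|[-> ch]].
  by split=> // -[_|i /ch //]; rewrite /= nth0 addnC -leq_subRL.
have := ch 0%N isT; rewrite /= nth0 => ch0.
have le_d : (d 0 <= v)%N by rewrite (leq_trans _ ch0) // leq_addl.
split=> //; apply/IHs; split; first by rewrite leq_subRL // addnC.
by move=> i; apply: (ch i.+1).
Qed.

(** The bound l drops along the recursion; a separate N keeps the entries in one type ['I_N]. *)
Lemma chain_sumE (q : S) n d l N : (l < N)%N ->
  \sum_(f : n.-tuple 'I_N | chain d l (map val f)) \prod_(i < n) q ^+ tnth f i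
  = chain_sum q n d l.
Proof.
elim: n d l => [|n IHn] d l lt_lN.
  rewrite (big_pred1 [tuple]) ?big_ord0 // => f.
  by rewrite (tuple0 f); apply/esym/eqP.
rewrite big_tuple_cons /=.
rewrite (big_ord_widen _ (fun v => q ^+ v * fps_shift (d 0) (chain_sum q n _) v) lt_lN).
rewrite [RHS]big_mkcond.
apply: eq_bigr => x _; rewrite ltnS.
have [le_xl|lt_lx] := leqP x l; last by rewrite big_pred0 // => f; rewrite /= leqNgt lt_lx.
rewrite /fps_shift; have [le_dx|lt_xd] := leqP (d 0) x; last first.
  by rewrite mulr0 big_pred0 // => f; rewrite /= le_xl leqNgt lt_xd.
rewrite -(IHn (fun i => d i.+1)) ?(leq_ltn_trans (leq_subr _ _)) // mulr_sumr.
apply: eq_big => [//|f _].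
by rewrite big_ord_recl tnth0; congr (_ * _); apply: eq_bigr => i _; rewrite tnthS.
Qed.

End Chains.

(** * The sorting permutation of a word *)

Section Standardization.
Variables (n l : nat).
Implicit Types (s : 'S_n) (w : n.-tuple 'I_l.+1).

Definition word_le w : rel 'I_n := fun a b =>
  (tnth w b < tnth w a)%N || (tnth w b == tnth w a) && (a <= b)%N.

Lemma word_le_total w : total (word_le w).
Proof. by move=> a b; rewrite /word_le -!val_eqE /=; lia. Qed.

Lemma word_le_trans w : transitive (word_le w).
Proof. by move=> b a c; rewrite /word_le -!val_eqE /=; lia. Qed.

Lemma word_le_anti w : antisymmetric (word_le w).
Proof.
move=> a b; rewrite /word_le -!val_eqE /= => ab; apply: val_inj => /=; lia.
Qed.

(* s lists the positions of w by decreasing letter, ties from left to right. *)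
Definition sorts s w := sorted (word_le w) [seq s i | i <- enum 'I_n].

(** Sorting the positions gives [s]; as ties are broken by position, [word_le] is antisymmetric and
    the sorted list is unique. *)
Lemma exists_sorts w : exists s, forall s', sorts s' w = (s' == s).
Proof.
have: perm_eq (sort (word_le w) (enum 'I_n)) (ord_tuple n) by rewrite perm_sort.
case/tuple_permP => s def_s; exists s => s'.
have sorts_s : sorts s w.
  rewrite /sorts; have -> : [seq s i | i <- enum 'I_n] = sort (word_le w) (enum 'I_n).
    by rewrite def_s; apply: eq_map => i; rewrite tnth_ord_tuple.
  exact: sort_sorted (word_le_total w) _.
apply/idP/eqP => [sorts_s'|-> //]; apply/permP => i.
have eq_ss' : [seq s' i | i <- enum 'I_n] = [seq s i | i <- enum 'I_n].
  apply: (sorted_eq (@word_le_trans w) (@word_le_anti w)) => //.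
  have uniq_map (u : 'S_n) : uniq [seq u i | i <- enum 'I_n].
    by rewrite (map_inj_uniq (@perm_inj _ u)) enum_uniq.
  apply: uniq_perm => //.
  move=> j; have onto (u : 'S_n) : j \in [seq u i | i <- enum 'I_n].
    by apply/mapP; exists ((u^-1)%g j); rewrite ?mem_enum // permKV.
  by rewrite !onto.
by move/eq_in_map: eq_ss' => ->; rewrite ?mem_enum.
Qed.

Lemma sorts_lt s w (i j : 'I_n) : sorts s w -> (i < j)%N -> word_le w (s i) (s j).
Proof.
move=> sorts_sw lt_ij.
have nth_s (k : 'I_n) : nth (s i) [seq s a | a <- enum 'I_n] k = s k.
  by rewrite (nth_map i) ?size_enum_ord // nth_ord_enum.
rewrite -(nth_s i) -(nth_s j).
apply: sorted_ltn_nth (@word_le_trans w) _ _ sorts_sw _ _ _ _ lt_ij;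
  by rewrite inE size_map size_enum_ord ltn_ord.
Qed.

(** For i < j sorting gives w_(s i) >= w_(s j), and s j < s i rules out a tie; conversely a larger
    letter is listed earlier. So inversions (i, j) match the pairs (s j, s i). *)
Lemma perm_inv_coinv s w :
  sorts s w -> Defs.perm_inv s = coinv (fun a b : 'I_l.+1 => (a < b)%N) w.
Proof.
move=> sorts_sw; rewrite /Defs.perm_inv -sum1_card big_mkcond /coinv.
under [RHS]eq_bigr do rewrite big_mkcond.
rewrite pair_big /= [RHS](reindex (fun ij : 'I_n * 'I_n => (s ij.2, s ij.1))) /=; last first.
  exists (fun ab => ((s^-1)%g ab.2, (s^-1)%g ab.1)) => -[a b] _ /=; by rewrite ?permK ?permKV.
apply: eq_bigr => -[i j] _; rewrite inE /= andbC.
have [lt_s /=|//] := ltnP (s j) (s i).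
have [lt_ij|lt_ji|/val_inj eq_ij] := ltngtP i j; last by rewrite eq_ij ltnn in lt_s.
  have := sorts_lt sorts_sw lt_ij; rewrite /word_le (leqNgt (s i)) lt_s andbF orbF.
  by move=> ->.
have := sorts_lt sorts_sw lt_ji; rewrite /word_le -val_eqE /=.
by case: ltngtP.
Qed.

(** [descent] extended by false to all naturals, as [chain] and [chain_sum] require. *)
Definition is_descent s (i : nat) := [exists j : 'I_n, (j == i :> nat) && descent s j].

Lemma is_descentE s (i : 'I_n) : is_descent s i = descent s i.
Proof.
apply/existsP/idP => [[j /andP[/eqP/val_inj-> //]]|di].
by exists i; rewrite eqxx.
Qed.

Lemma perm_desE s : perm_des s = (\sum_(i < n) is_descent s i)%N.
Proof.
rewrite /perm_des -sum1_card big_mkcond; apply: eq_bigr => i _.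
by rewrite inE is_descentE; case: descent.
Qed.

Lemma perm_majE s : perm_maj s = (\sum_(i < n) is_descent s i * i.+1)%N.
Proof.
rewrite /perm_maj big_mkcond; apply: eq_bigr => i _.
by rewrite is_descentE; case: descent; rewrite ?mul1n.
Qed.

End Standardization.

(** Equal letters adjacent in the list must sit at increasing positions, so w read along [s] has to
    drop strictly exactly at the descents of [s]. *)
Lemma sorts_chain n l (s : 'S_n) (w : n.-tuple 'I_l.+1) :
  sorts s w = chain (is_descent s) l (map val [tuple tnth w (s i) | i < n]).
Proof.
case: n s w => [|n] s w.
  have e0 : enum 'I_0 = [::] by apply: size0nil; rewrite size_enum_ord.
  by rewrite /sorts /= e0.
set f := map val _.
have size_f : size f = n.+1 by rewrite size_map size_tuple.
have nth_f i (lt_i : (i < n.+1)%N) : nth 0%N f i = tnth w (s (Ordinal lt_i)).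
  rewrite (nth_map ord0) ?size_tuple //.
  by rewrite -(tnth_nth _ _ (Ordinal lt_i)) tnth_mktuple.
have nth_s i (lt_i : (i < n.+1)%N) :
    nth ord0 [seq s i | i <- enum 'I_n.+1] i = s (Ordinal lt_i).
  by rewrite (nth_map ord0) ?size_enum_ord // (nth_ord_enum _ (Ordinal lt_i)).
have descent_s i (lt_i : (i < n.+1)%N) (lt_i1 : (i.+1 < n.+1)%N) :
    is_descent s i = (s (Ordinal lt_i1) < s (Ordinal lt_i))%N.
  rewrite (is_descentE s (Ordinal lt_i)); apply/existsP/idP => [[j /andP[/eqP eq_j]]|lt_s].
    by rewrite (_ : j = Ordinal lt_i1) //; apply: val_inj.
  by exists (Ordinal lt_i1); rewrite eqxx.
have descent_last i : (i < n.+1)%N -> (n.+1 <= i.+1)%N -> is_descent s i = false.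
  move=> lt_i le_ni; rewrite (is_descentE s (Ordinal lt_i)).
  apply/existsP => -[j /andP[/eqP/= eq_j _]].
  by have := ltn_ord j; rewrite eq_j ltnNge le_ni.
have size_s : size [seq s i | i <- enum 'I_n.+1] = n.+1.
  by rewrite size_map size_enum_ord.
rewrite /sorts; apply/(sortedP ord0)/chainP; rewrite size_s; last first.
  case=> _ le_f i lt_i1; have lt_i : (i < n.+1)%N by apply: ltnW.
  move: (le_f i); rewrite size_f (nth_f _ lt_i) (nth_f _ lt_i1) (descent_s _ lt_i lt_i1).
  by rewrite (nth_s _ lt_i) (nth_s _ lt_i1) /word_le -val_eqE /=; lia.
move=> le_s.
split; first by rewrite -nth0 (nth_f _ (ltn0Sn n)) leq_ord.
move=> i; rewrite size_f => lt_i; rewrite (nth_f i lt_i).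
(* The last index is never a descent, so the comparison with the default 0 is free. *)
have [le_ni|lt_i1] := leqP n.+1 i.+1.
  by rewrite nth_default ?size_f // descent_last.
rewrite (nth_f _ lt_i1) (descent_s _ lt_i lt_i1).
move: (le_s i lt_i1); rewrite (nth_s _ lt_i) (nth_s _ lt_i1) /word_le -val_eqE /=; lia.
Qed.

(** * From permutations to words, and roots of unity *)

(** Words are grouped by sorting permutation; those sorted by s, read along s, are the chains with
    strict steps at the descents of s. *)
Lemma Euler3_word_sum (S : comNzRingType) (n l : nat) (q p : S) :
  fps_div (Euler3 n ('X : {poly S}) q%:P p%:P) (qasc ('X : {poly S}) q%:P n.+1) l =
  iter n (word_op p l.+1) (fun=> 1 : S^o) (fun j => q ^+ j).
Proof.
rewrite /Euler3 fps_div_suml -word_sum.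
transitivity (\sum_(s : 'S_n) \sum_(w : n.-tuple 'I_l.+1 | sorts s w)
    (\prod_(a < n) q ^+ tnth w a) * p ^+ coinv (fun a b : 'I_l.+1 => (a < b)%N) w).
  apply: eq_bigr => s _; rewrite -!rmorphXn fps_div_mulC perm_desE perm_majE chain_sumP.
  rewrite -(chain_sumE _ _ _ (ltnSn l)) mulr_suml.
  rewrite (reindex (fun w : n.-tuple 'I_l.+1 => [tuple tnth w (s i) | i < n])) /=; last first.
    exists (fun w => [tuple tnth w ((s^-1)%g i) | i < n]) => w _;
      by apply: eq_from_tnth => i; rewrite !tnth_mktuple ?permK ?permKV.
  apply: eq_big => [w|w]; first by rewrite -sorts_chain.
  rewrite -sorts_chain => /perm_inv_coinv->; congr (_ * _).
  rewrite [RHS](reindex_inj (@perm_inj _ s)) /=.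
  by apply: eq_bigr => i _; rewrite tnth_mktuple.
(* After the exchange each word is met once, at its unique sorting permutation. *)
rewrite (exchange_big_dep predT) //=; apply: eq_bigr => w _.
have [s sorts_w] := exists_sorts w.
by rewrite (big_pred1 s).
Qed.

Lemma prim_root_lreg (D : idomainType) m (p : D) :
  m.-primitive_root p -> forall a, (0 < a < m)%N -> GRing.lreg (1 - p ^+ a).
Proof.
move=> prim_p a /andP[a_gt0 lt_am]; apply: mulfI.
by rewrite subr_eq0 eq_sym -(prim_order_dvd prim_p) gtnNdvd.
Qed.

Lemma polyC_prim_root (D : nzRingType) m (z : D) :
  m.-primitive_root (z%:P : {poly D}) = m.-primitive_root z.
Proof.
congr (_ && _); apply: eq_forallb => i.
by rewrite !unity_rootE -rmorphXn /= -polyC1 (inj_eq polyC_inj).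
Qed.

Lemma prim_root1 (D : nzRingType) : 1.-primitive_root (1 : D).
Proof.
apply/andP; split=> //; apply/forallP => i.
by rewrite ord1 unity_rootE expr1 !eqxx.
Qed.

(** The case m = 1, where the cancellation condition is vacuous and zero divisors are allowed. *)
Lemma iter_word_op1 (S : comNzRingType) (V : lmodType S) k l (f : (nat -> S) -> V) x :
  iter k (word_op 1 l) f x = (\sum_(j < l) x j) ^+ k *: f x.
Proof.
rewrite -[in iter k](addn0 k) -[k in LHS]mul1n iter_word_op_mul ?(prim_root1 S) //.
by case=> [|a].
Qed.

Lemma Euler2_word_sum (S : comNzRingType) (k l : nat) (q : S) :
  fps_div (Euler2 k ('X : {poly S}) q%:P) (qasc ('X : {poly S}) q%:P k.+1) l =
  (\sum_(j < l.+1) q ^+ j) ^+ k.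
Proof. by rewrite /Euler2 -polyC1 Euler3_word_sum iter_word_op1 [LHS]mulr1. Qed.

(** A general domain D allows D = [{poly R[i]}] with q its indeterminate. *)
Lemma Euler3_prim_root (D : idomainType) (m k i l : nat) (q p : D) :
  m.-primitive_root p ->
  fps_div (Euler3 (m * k + i) ('X : {poly D}) q%:P p%:P)
    (qasc ('X : {poly D}) q%:P (m * k + i).+1) l =
  fps_div (Euler3 i ('X : {poly D}) q%:P p%:P) (qasc ('X : {poly D}) q%:P i.+1) l *
  fps_div (Euler2 k ('X : {poly D}) (q ^+ m)%:P) (qasc ('X : {poly D}) (q ^+ m)%:P k.+1) l.
Proof.
move=> prim_p; rewrite Euler2_word_sum !Euler3_word_sum.
rewrite (iter_word_op_mul _ _ _ _ _ prim_p (prim_root_lreg prim_p)) mulrC.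
(* Here (q^m)^j = (q^j)^m identifies the word sum for q^m with the power sum. *)
by under [in RHS]eq_bigr do rewrite exprAC.
Qed.

Theorem theorem1 (R : realType) (m : nat) (xi : R[i]) (n k i : nat) :
  (0 < m)%N -> m.-primitive_root xi ->
  (0 < n)%N -> n = (m * k + i)%N -> (i < m)%N ->
  let t : {poly {poly R[i]}} := 'X in
  let q : {poly {poly R[i]}} := 'X%:P in
  let p : {poly {poly R[i]}} := xi%:P%:P in
  fps_div (Euler3 n t q p) (qasc t q n.+1)
  =1 hadamard
       (fps_div (Euler3 i t q p) (qasc t q i.+1))
       (fps_div (Euler2 k t (q ^+ m)) (qasc t (q ^+ m) k.+1)).
Proof.
move=> _ prim_xi _ -> _ t q p l; rewrite /hadamard /q -rmorphXn.
by apply: Euler3_prim_root; rewrite polyC_prim_root.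
Qed.
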